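(* Let $S\subseteq\mathbb{R}^d$ be nonempty, compact and convex, let $\lambda\ge 0$, and let $\Omega:\mathbb{R}^{d\times p}\to\mathbb{R}$ be convex. Let $(x_i,c_i)\in\mathbb{R}^p\times\mathbb{R}^d$ for $i\in\{1,\ldots,n\}$, $B\in\mathbb{R}^{d\times p}$, and $\Psi\in\partial\Omega(B)$ be given, and define $\phi_i(B') := \ell_{\mathrm{SPO+}}(B'x_i,c_i)+\lambda\Omega(B')$ for $B'\in\mathbb{R}^{d\times p}$. Then, for each $i \in \{1,\ldots,n\}$, $$2\left(w^*(c_i)-w^*(2Bx_i-c_i)\right)x_i^T+\lambda\Psi\in\partial\phi_i(B).$$
   Context: For $c\in\mathbb{R}^d$: $z^*(c) := \min_{w\in S} c^Tw$, and $w^*(\cdot):\mathbb{R}^d\to S$ is a fixed oracle, i.e., an arbitrary fixed mapping with $w^*(c)\in\arg\min_{w\in S} c^Tw$ for all $c$. The SPO+ loss is $\ell_{\mathrm{SPO+}}(\hat c,c) := \max_{w\in S}\{c^Tw-2\hat c^Tw\}+2\hat c^Tw^*(c)-z^*(c)$. Subgradients of functions on $\mathbb{R}^{d\times p}$ are with respect to the trace inner product $B_1\bullet B_2 := \mathrm{trace}(B_1^TB_2)$: $G\in\partial h(B)$ iff $h(B')\ge h(B)+G\bullet(B'-B)$ for all $B'\in\mathbb{R}^{d\times p}$. *)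

(* Defs.v *)
(* MathComp-Analysis: R : realType, R^d is 'cV[R]_d, R^(d x p) is 'M[R]_(d, p) *)
From HB Require Import structures.
From mathcomp Require Export all_boot all_order all_algebra.
From mathcomp Require Export boolp classical_sets reals topology normedtype.
From mathcomp Require Export convex.

Set Implicit Arguments.
Unset Strict Implicit.
Unset Printing Implicit Defensive.

Import Order.TTheory GRing.Theory Num.Theory.
Export numFieldNormedType.Exports.

Local Open Scope classical_set_scope.
Local Open Scope ring_scope.

(* u^T v, read off from a 1 x 1 matrix product. *)
Definition dot (R : realType) (d : nat) (u v : 'cV[R]_d) : R :=
  (u^T *m v) 0 0.

Definition trace_inner (R : realType) (d p : nat) (B1 B2 : 'M[R]_(d, p)) : R :=
  \tr (B1^T *m B2).

(* Attained extrema, not suprema and infima: the value is an element of A. *)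
(* The default 0 is returned only if A has no greatest (resp. least) element. *)
Definition set_max (R : realType) (A : set R) : R :=
  xget 0 (A `&` ubound A).

Definition set_min (R : realType) (A : set R) : R :=
  xget 0 (A `&` lbound A).

Definition argmin (T : Type) (R : realType) (S : set T) (f : T -> R) : set T :=
  [set w | S w /\ forall v, S v -> f w <= f v].

Definition subdifferential (R : realType) (d p : nat)
    (h : 'M[R]_(d, p) -> R) (B : 'M[R]_(d, p)) : set 'M[R]_(d, p) :=
  [set G | forall B', h B' >= h B + trace_inner G (B' - B)].

Definition zstar (R : realType) (d : nat) (S : set 'cV[R]_d) (c : 'cV[R]_d) : R :=
  set_min [set dot c w | w in S].

Definition optimization_oracle (R : realType) (d : nat) (S : set 'cV[R]_d)
    (wstar : 'cV[R]_d -> 'cV[R]_d) : Prop :=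
  forall c, argmin S (dot c) (wstar c).

Definition spo_plus_loss (R : realType) (d : nat) (S : set 'cV[R]_d)
    (wstar : 'cV[R]_d -> 'cV[R]_d) (chat c : 'cV[R]_d) : R :=
  set_max [set dot c w - 2 * dot chat w | w in S]
  + 2 * dot chat (wstar c) - zstar S c.

(* Main.v *)
(* The maximum in the SPO+ loss at (chat, c) is attained at wstar (2 chat - c).
   The loss is thus a maximum of functions affine in chat, and the slope
   2 (wstar c - wstar (2 chat - c)) of an active one is a subgradient there; the
   chain rule for the linear map B |-> B x turns it into an outer product. *)
Require Import Defs.
From mathcomp Require Import lra.
Import GRing.Theory Num.Theory.
Local Open Scope classical_set_scope.
Local Open Scope ring_scope.

Lemma dotC (R : realType) (d : nat) (u v : 'cV[R]_d) : dot u v = dot v u.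
Proof. by rewrite /dot -[in LHS](trmxK v) -trmx_mul mxE. Qed.

Lemma dotBr (R : realType) (d : nat) (u v w : 'cV[R]_d) :
  dot u (v - w) = dot u v - dot u w.
Proof. by rewrite /dot mulmxBr !mxE. Qed.

Lemma dotBl (R : realType) (d : nat) (u v w : 'cV[R]_d) :
  dot (u - v) w = dot u w - dot v w.
Proof. by rewrite dotC dotBr !(dotC _ _ w). Qed.

Lemma dotZl (R : realType) (d : nat) (a : R) (u v : 'cV[R]_d) :
  dot (a *: u) v = a * dot u v.
Proof. by rewrite /dot linearZ /= -scalemxAl mxE. Qed.

Lemma trace_innerDl (R : realType) (d p : nat) (A B C : 'M[R]_(d, p)) :
  trace_inner (A + B) C = trace_inner A C + trace_inner B C.
Proof. by rewrite /trace_inner linearD /= mulmxDl mxtraceD. Qed.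

Lemma trace_innerZl (R : realType) (d p : nat) (a : R) (A B : 'M[R]_(d, p)) :
  trace_inner (a *: A) B = a * trace_inner A B.
Proof. by rewrite /trace_inner linearZ /= -scalemxAl mxtraceZ. Qed.

(** By cyclicity the trace of [x u^T D] is that of the 1 x 1 matrix [u^T D x]. Thus [u x^T] is the
    image of [u] under the adjoint of [D |-> D x]. *)
Lemma trace_inner_outer (R : realType) (d p : nat)
    (u : 'cV[R]_d) (x : 'cV[R]_p) (D : 'M[R]_(d, p)) :
  trace_inner (u *m x^T) D = dot u (D *m x).
Proof.
by rewrite /trace_inner trmx_mul trmxK -mulmxA mxtrace_mulC /mxtrace big_ord1
  /dot mulmxA.
Qed.

(** Two greatest elements bound each other, so the choice made by [xget] is forced and its default
    is not returned. *)
Lemma set_maxE (R : realType) (A : set R) (m : R) :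
  A m -> ubound A m -> set_max A = m.
Proof.
move=> Am ubm; apply: xget_unique => // y [Ay uby].
have := ubm _ Ay; have := uby _ Am; lra.
Qed.

(** The function maximized in the loss is the negative of [dot (2 *: chat - c)], which the oracle
    minimizes over [S]. *)
Lemma spo_plus_lossE (R : realType) (d : nat) (S : set 'cV[R]_d)
    (wstar : 'cV[R]_d -> 'cV[R]_d) (chat c : 'cV[R]_d) :
  optimization_oracle S wstar ->
  let w := wstar (2 *: chat - c) in
  spo_plus_loss S wstar chat c =
    dot c w - 2 * dot chat w + 2 * dot chat (wstar c) - zstar S c.
Proof.
move=> /(_ (2 *: chat - c)) [Sw w_min] w; rewrite /spo_plus_loss.
rewrite (set_maxE _ _ (dot c w - 2 * dot chat w)) //; first by exists w.
move=> _ [v /w_min + <-]; rewrite !dotBl !dotZl -/w; lra.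
Qed.

Lemma spo_plus_loss_subgradient (R : realType) (d : nat) (S : set 'cV[R]_d)
    (wstar : 'cV[R]_d -> 'cV[R]_d) (chat chat' c : 'cV[R]_d) :
  optimization_oracle S wstar ->
  spo_plus_loss S wstar chat c
    + 2 * dot (wstar c - wstar (2 *: chat - c)) (chat' - chat)
  <= spo_plus_loss S wstar chat' c.
Proof.
move=> wstarP; rewrite !spo_plus_lossE //=.
(* The maximizer for [chat] is a feasible competitor in the maximum for [chat']. *)
have [_ /(_ (wstar (2 *: chat - c)))] := wstarP (2 *: chat' - c).
have [Sw _] := wstarP (2 *: chat - c).
move=> /(_ Sw).
(* The swap puts cost vectors on the left throughout, so that the expanded products agree as atoms
   for [lra]. *)
rewrite (dotC _ _ (_ - wstar _)) !dotBl !dotBr !dotZl; lra.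
Qed.

Theorem proposition8 (R : realType) (d p n : nat)
    (S : set 'cV[R]_d) (wstar : 'cV[R]_d -> 'cV[R]_d)
    (lambda : R) (Omega : 'M[R]_(d, p) -> R)
    (x : 'I_n -> 'cV[R]_p) (c : 'I_n -> 'cV[R]_d)
    (B Psi : 'M[R]_(d, p))
    (S_nonempty : S !=set0)
    (S_compact : compact S)
    (S_convex : convex_set S)
    (wstar_oracle : optimization_oracle S wstar)
    (lambda_ge0 : 0 <= lambda)
    (Omega_convex : convex_function [set: 'M[R]_(d, p)] Omega)
    (Psi_subgradient : subdifferential Omega B Psi)
    (phi := fun (i : 'I_n) (B' : 'M[R]_(d, p)) =>
       spo_plus_loss S wstar (B' *m x i) (c i) + lambda * Omega B') :
  forall i : 'I_n,
    subdifferential (phi i) B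
      (2 *: ((wstar (c i) - wstar (2 *: (B *m x i) - c i)) *m (x i)^T)
       + lambda *: Psi).
Proof.
move=> i B'; rewrite /phi trace_innerDl !trace_innerZl trace_inner_outer mulmxBl.
have := spo_plus_loss_subgradient _ _ S wstar
  (B *m x i) (B' *m x i) (c i) wstar_oracle.
(* Sum rule: the inequality for the loss is added to [lambda] times the one for [Omega]. *)
have := ler_wpM2l lambda_ge0 (Psi_subgradient B'); lra.
Qed.
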